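(* Let $0<a\le b\le c$ and let $B\subset\mathbb{R}^3$ be a rectangular box with edge lengths $a,b,c$. If the orthogonal projection $H$ of $B$ onto a plane is a hexagon, then the interior of $H$ (relative to that plane) contains a rectangle with side lengths $a$ and $b$. Equivalently, $B$ has a Rupert's passage in every direction that is not parallel to any face of $B$. In particular, every cube has a Rupert's passage in every direction that is not parallel to any of its faces.
   Context: A rectangular box is a solid (closed) rectangular parallelepiped, and rectangles are closed two-dimensional regions. For a nonzero vector $v$, let $\pi_v$ denote the orthogonal projection of $\mathbb{R}^3$ onto the plane through the origin perpendicular to $v$. A rectangular box $B$ has a Rupert's passage in the direction $v$ if a straight tunnel parallel to $v$ can be cut in $B$ through which a second box congruent to $B$ can be passed by translation in the direction $v$; that is, if there is a box $B'$ congruent to $B$ (in any position and orientation) such that $\pi_v(B')$ is contained in the interior of $\pi_v(B)$ relative to the plane $v^{\perp}$. The projection $\pi_v(B)$ is a (nondegenerate) hexagon exactly when $v$ is not parallel to any face of $B$. *)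

(* Defs.v *)
From mathcomp Require Import all_boot all_order all_algebra.
From mathcomp Require Import all_classical all_reals all_analysis.

Set Implicit Arguments.
Unset Strict Implicit.
Unset Printing Implicit Defensive.

Import Order.TTheory GRing.Theory Num.Theory.
Import numFieldNormedType.Exports.

Local Open Scope classical_set_scope.
Local Open Scope ring_scope.

Definition dot (R : realType) (u v : 'rV[R]_3) : R := \sum_i u 0 i * v 0 i.

(* Euclidean distance: the library norm on 'rV[R]_3 is the sup norm (which
   induces the same topology). *)
Definition eucl_dist (R : realType) (u v : 'rV[R]_3) : R :=
  Num.sqrt (dot (u - v) (u - v)).

Definition congruent (R : realType) (A B : set 'rV[R]_3) : Prop :=
  exists f : 'rV[R]_3 -> 'rV[R]_3,
    (forall x y, eucl_dist (f x) (f y) = eucl_dist x y) /\ B = f @` A.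

Definition plane (R : realType) (n : 'rV[R]_3) (d : R) : set 'rV[R]_3 :=
  [set x | dot x n = d].

(* Orthogonal projection onto plane n d, for n != 0. *)
Definition orth_proj (R : realType) (n : 'rV[R]_3) (d : R) (x : 'rV[R]_3) :
    'rV[R]_3 :=
  x - ((dot x n - d) / dot n n) *: n.

(* Interior for the topology induced on P; only meant for A `<=` P, since the
   library makes the points outside P isolated in subspace P. *)
Definition relint (R : realType) (P A : set 'rV[R]_3) : set 'rV[R]_3 :=
  @interior (subspace P) A.

(* When the rows of E are orthonormal, this is the m-dimensional closed box
   with corner p and edge vectors tnth l i *: row i E. *)
Definition brick (R : realType) (m : nat) (l : m.-tuple R) (p : 'rV[R]_3)
    (E : 'M[R]_(m, 3)) : set 'rV[R]_3 :=
  [set p + t *m E | t in [set t : 'rV[R]_m |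
     forall i, 0 <= t 0 i <= tnth l i]].

(* The side of the brick where the i-th coordinate is maximal (s = true) or
   zero (s = false). *)
Definition brick_side (R : realType) (m : nat) (l : m.-tuple R) (p : 'rV[R]_3)
    (E : 'M[R]_(m, 3)) (i : 'I_m) (s : bool) : set 'rV[R]_3 :=
  [set p + t *m E | t in [set t : 'rV[R]_m |
     (forall j, 0 <= t 0 j <= tnth l j) /\
     t 0 i = if s then tnth l i else 0]].

Definition is_box (R : realType) (a b c : R) (B : set 'rV[R]_3) : Prop :=
  exists (p : 'rV[R]_3) (E : 'M[R]_3),
    E *m E^T = 1%:M /\ B = brick [tuple a; b; c] p E.

Definition is_cube (R : realType) (B : set 'rV[R]_3) : Prop :=
  exists2 s : R, 0 < s & is_box s s s B.

Definition is_rectangle (R : realType) (a b : R) (T : set 'rV[R]_3) : Prop :=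
  exists (p : 'rV[R]_3) (E : 'M[R]_(2, 3)),
    E *m E^T = 1%:M /\ T = brick [tuple a; b] p E.

Definition is_face (R : realType) (B F : set 'rV[R]_3) : Prop :=
  exists (l : 3.-tuple R) (p : 'rV[R]_3) (E : 'M[R]_3),
    [/\ forall i, 0 < tnth l i, E *m E^T = 1%:M, B = brick l p E &
        exists i s, F = brick_side l p E i s].

(* A two-dimensional face F contains a segment in every direction of the plane
   it spans, so this says that v is parallel to that plane. *)
Definition parallel (R : realType) (v : 'rV[R]_3) (F : set 'rV[R]_3) : Prop :=
  exists x y (k : R), [/\ F x, F y & v = k *: (y - x)].

Definition conv_hull (R : realType) (I : finType) (P : pred I)
    (p : I -> 'rV[R]_3) : set 'rV[R]_3 :=
  [set x | exists w : I -> R,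
     [/\ forall i, P i -> 0 <= w i, \sum_(i | P i) w i = 1 &
         x = \sum_(i | P i) w i *: p i]].

(* Nondegenerate (convex) hexagon in the plane P, with vertices p i. *)
Definition is_hexagon (R : realType) (P H : set 'rV[R]_3) : Prop :=
  exists p : 'I_6 -> 'rV[R]_3,
    [/\ forall i, P (p i),
        forall i, ~ conv_hull (predC1 i) p (p i) &
        H = conv_hull predT p].

Definition rupert_passage (R : realType) (B : set 'rV[R]_3) (v : 'rV[R]_3) :
    Prop :=
  exists2 B' : set 'rV[R]_3, congruent B B' &
    orth_proj v 0 @` B' `<=` relint (plane v 0) (orth_proj v 0 @` B).

(* Main.v *)
Require Import Defs.
From mathcomp Require Import all_boot all_order all_algebra.
From mathcomp Require Import all_classical all_reals all_analysis.
From mathcomp Require Import ring lra.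

Set Implicit Arguments.
Unset Strict Implicit.
Unset Printing Implicit Defensive.

Import Order.TTheory GRing.Theory Num.Theory.
Import numFieldNormedType.Exports.

Local Open Scope classical_set_scope.
Local Open Scope ring_scope.

(* In the frame of the box, the direction of projection u has no zero
   component, as otherwise the projection would be a parallelogram; choosing the
   signs of the edge vectors, assume u > 0.  A point of the plane u^perp lies in
   the open hexagon as soon as it satisfies three strip inequalities.  For
   orthonormal e, f in u^perp, the vectors e x u and f x u are, up to sign,
   |u| f and |u| e; so, for a rectangle with sides a e and b f centred at the
   centre of the hexagon, these inequalities read
     |u| (a |f_k| + b |e_k|) < l_i u_j + l_j u_i   ({i, j, k} = {0, 1, 2}),
   where l = (a, b, c).  If a u_0 <= b u_1 and a u_0 <= b u_2, the frame with
   f_0 = 0 satisfies them; otherwise, with m the index of the smaller one of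
   u_1 and u_2, the frame with e_m = 0 does.  Adding a third edge of length c
   along u to this rectangle gives the box that passes through the tunnel. *)

(** * Sums and case analysis over small index types *)

Lemma sum_ord3 (V : nmodType) (F : 'I_3 -> V) :
  \sum_i F i = F 0 + F 1 + F 2.
Proof.
rewrite !big_ord_recl big_ord0 addr0 addrA.
by congr (F _ + F _ + F _); apply/val_inj.
Qed.

Lemma forall_ord3 (P : 'I_3 -> Prop) : P 0 -> P 1 -> P 2 -> forall i, P i.
Proof.
by move=> P0 P1 P2 [[|[|[|//]]] i3];
  [move: P0 | move: P1 | move: P2]; congr P; apply/val_inj.
Qed.

Lemma sum_bool2 (V : nmodType) (F : bool * bool -> V) : \sum_k F k =
  F (true, true) + F (true, false) + (F (false, true) + F (false, false)).
Proof.
rewrite (eq_bigr (fun k => F (k.1, k.2))) => [|[]//].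
by rewrite -(pair_bigA _ (fun b b' => F (b, b'))) /= !big_bool.
Qed.

Lemma forall_ord2 (P : 'I_2 -> Prop) : P 0 -> P 1 -> forall i, P i.
Proof.
by move=> P0 P1 [[|[|//]] i2];
  [move: P0 | move: P1]; congr P; apply/val_inj.
Qed.

(** Lets an arbitrary axis [i] be singled out later without treating three cases. *)
Lemma ord3_others (i : 'I_3) : exists j k, [/\ j != i, k != i, k != j &
  forall (V : nmodType) (F : 'I_3 -> V), \sum_r F r = F i + F j + F k].
Proof.
move: i; apply: forall_ord3; [exists 1, 2|exists 0, 2|exists 0, 1];
  split=> // V F; rewrite sum_ord3 //.
- by rewrite (addrC (F 1)).
- by rewrite addrC addrA.
Qed.

(** * Inner products and orthonormal rows *)

Section Dot.
Variable R : realType.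
Implicit Types (u v w : 'rV[R]_3) (E : 'M[R]_3).

Definition vec3 (x y z : R) : 'rV[R]_3 := \row_i [:: x; y; z]`_i.

Lemma vec3_eta u : u = vec3 (u 0 0) (u 0 1) (u 0 2).
Proof. by apply/rowP; apply: forall_ord3; rewrite mxE. Qed.

Lemma dot_mulmx u v : dot u v = (u *m v^T) 0 0.
Proof. by rewrite mxE; apply: eq_bigr => i _; rewrite mxE. Qed.

Lemma dotC u v : dot u v = dot v u.
Proof. by apply: eq_bigr => i _; rewrite mulrC. Qed.

Lemma dotDl u v w : dot (u + v) w = dot u w + dot v w.
Proof. by rewrite !dot_mulmx mulmxDl mxE. Qed.

Lemma dotZl (k : R) u v : dot (k *: u) v = k * dot u v.
Proof. by rewrite !dot_mulmx -scalemxAl mxE. Qed.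

Lemma dotBl u v w : dot (u - v) w = dot u w - dot v w.
Proof. by rewrite -scaleN1r dotDl dotZl mulN1r. Qed.

Lemma dotZr (k : R) u v : dot u (k *: v) = k * dot u v.
Proof. by rewrite dotC dotZl dotC. Qed.

Lemma dotBr u v w : dot u (v - w) = dot u v - dot u w.
Proof. by rewrite dotC dotBl !(dotC u). Qed.

Lemma dot_ge0 u : 0 <= dot u u.
Proof. by apply: sumr_ge0 => i _; rewrite -expr2 sqr_ge0. Qed.

Lemma dot_gt0 u : u != 0 -> 0 < dot u u.
Proof.
move=> u0; rewrite lt_def dot_ge0 andbT; apply: contraNneq u0 => /eqP.
rewrite psumr_eq0 => [/allP u0|i _]; last by rewrite -expr2 sqr_ge0.
apply/eqP/rowP => i; rewrite mxE; apply/eqP.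
by move: (u0 i); rewrite mem_index_enum mulf_eq0 orbb; apply.
Qed.

Lemma dot_mul_orthonormal E u v :
  E *m E^T = 1%:M -> dot (u *m E) (v *m E) = dot u v.
Proof.
by move=> EE; rewrite !dot_mulmx trmx_mul mulmxA -(mulmxA u) EE mulmx1.
Qed.

Lemma mul_tr_orthonormal E u : E *m E^T = 1%:M -> u *m E^T *m E = u.
Proof. by move=> EE; rewrite -mulmxA (mulmx1C EE) mulmx1. Qed.

Lemma mulmx_trE m k (A : 'M[R]_(m, 3)) (B : 'M[R]_(k, 3)) i j :
  (A *m B^T) i j = dot (row i A) (row j B).
Proof. by rewrite mxE; apply: eq_bigr => r _; rewrite !mxE. Qed.

Lemma dot_row_orthonormal m (E : 'M[R]_(m, 3)) i j :
  E *m E^T = 1%:M -> dot (row i E) (row j E) = (i == j)%:R.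
Proof. by move=> EE; rewrite -mulmx_trE EE mxE. Qed.

End Dot.

(** * Orthogonal projection onto a plane *)

Section Projection.
Variable R : realType.
Implicit Types (n x y : 'rV[R]_3) (d : R).

Lemma orth_proj_plane n d x : n != 0 -> plane n d (orth_proj n d x).
Proof.
move=> n0; rewrite /plane /orth_proj /= dotBl dotZl divfK; last first.
  by rewrite gt_eqF ?dot_gt0.
by rewrite subKr.
Qed.

Lemma orth_projD n d x y : dot y n = 0 ->
  orth_proj n d (x + y) = orth_proj n d x + y.
Proof. by move=> yn; rewrite /orth_proj dotDl yn addr0 addrAC. Qed.

Lemma orth_projDn n d x k : n != 0 ->
  orth_proj n d (x + k *: n) = orth_proj n d x.
Proof.
move=> n0; rewrite /orth_proj dotDl dotZl (addrAC (dot x n)) mulrDl mulfK.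
  by rewrite scalerDl opprD addrACA subrr addr0.
by rewrite gt_eqF ?dot_gt0.
Qed.

Lemma orth_proj_id n d x : plane n d x -> orth_proj n d x = x.
Proof. by move=> xn; rewrite /orth_proj xn subrr mul0r scale0r subr0. Qed.

End Projection.

(* Helly's theorem on the line: the intervals of admissible [t] for the single
   coordinates meet as soon as they meet pairwise. *)
Lemma exists_shift (R : realFieldType) k (m x u : 'rV[R]_k.+1) :
  (forall i, 0 < u 0 i) ->
  (forall i j, x 0 i * u 0 j - x 0 j * u 0 i < m 0 i * u 0 j + m 0 j * u 0 i) ->
  exists t, forall i, `|x 0 i + t * u 0 i| < m 0 i.
Proof.
move=> u0 H.
(* [lo i] and [hi i] bound the [t] admissible for coordinate [i]; the midpoint of the largest [lo]
   and the smallest [hi] serves all coordinates. *)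
pose lo i := (- m 0 i - x 0 i) / u 0 i; pose hi i := (m 0 i - x 0 i) / u 0 i.
case: (@arg_maxP _ _ _ ord0 xpredT lo isT) => i _ lei.
case: (@arg_minP _ _ _ ord0 xpredT hi isT) => j _ lej.
have ltij : lo i < hi j.
  rewrite /lo /hi ltr_pdivrMr // mulrAC ltr_pdivlMr //.
  have := H j i; lra.
exists ((lo i + hi j) / 2) => r.
have lor : lo r < (lo i + hi j) / 2 by have /= : lo r <= lo i := lei r isT; lra.
have hir : (lo i + hi j) / 2 < hi r by have /= : hi j <= hi r := lej r isT; lra.
move: lor hir; rewrite ltr_pdivrMr // ltr_pdivlMr // => lor hir.
by rewrite ltr_norml; apply/andP; split; lra.
Qed.

(** * Real inequalities behind the strip conditions *)

(** Multiplying by [(N + s) * (s + z)] turns [N - s] into [x ^+ 2] and [s - z] into [y ^+ 2]. After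
    division by [x * y], what remains is [a * x * (s + z) < b * y * (N + s)], which holds because
    [z < N]. *)
Lemma sub_norm_lt (R : rcfType) (a b x y z s N : R) :
  0 < a -> 0 < b -> 0 < x -> 0 < y -> 0 < z -> 0 < s -> 0 < N ->
  s ^+ 2 = y ^+ 2 + z ^+ 2 -> N ^+ 2 = x ^+ 2 + s ^+ 2 ->
  a * x <= b * y -> a * y * (N - s) < b * x * (s - z).
Proof.
move=> a0 b0 x0 y0 z0 s0 N0 sE NE le.
have zN : z < N by rewrite -(@ltr_pXn2r _ 2) ?nnegrE ?ltW//; nra.
have pos : 0 < (N + s) * (s + z) by nra.
rewrite -(ltr_pM2r pos).
have -> : a * y * (N - s) * ((N + s) * (s + z)) = a * x * (s + z) * (x * y).
  transitivity (a * y * (N ^+ 2 - s ^+ 2) * (s + z)); first by ring.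
  by rewrite NE; ring.
have -> : b * x * (s - z) * ((N + s) * (s + z)) = b * y * (N + s) * (x * y).
  transitivity (b * x * (s ^+ 2 - z ^+ 2) * (N + s)); first by ring.
  by rewrite sE; ring.
rewrite ltr_pM2r ?mulr_gt0//.
apply: (@le_lt_trans _ _ (b * y * (s + z))); first by rewrite ler_wpM2r//; lra.
by rewrite ltr_pM2l ?mulr_gt0//; lra.
Qed.

(** Removes the absolute values and the denominator [s] from a strip condition whose terms are known
    up to sign. *)
Lemma normM_add_lt (R : realFieldType) (a b X Y p q s D : R) :
  0 < s -> 0 <= p -> 0 <= q -> X * s = p \/ X * s = - p ->
  Y * s = q \/ Y * s = - q -> a * p + b * q < s * D ->
  a * `|X| + b * `|Y| < D.
Proof.
move=> s0 p0 q0 Xp Yq lt; rewrite -(ltr_pM2l s0).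
have -> : s * (a * `|X| + b * `|Y|) = a * `|X * s| + b * `|Y * s|.
  by rewrite !normrM (gtr0_norm s0); ring.
have -> : `|X * s| = p by case: Xp => ->; rewrite ?normrN ger0_norm.
by have -> : `|Y * s| = q by case: Yq => ->; rewrite ?normrN ger0_norm.
Qed.

(** * A rectangle frame satisfying the strip inequalities *)

Section Frame.
Variable R : realType.
Implicit Types (u l e f : 'rV[R]_3).

Definition is_frame u e f :=
  [/\ dot e e = 1, dot f f = 1, dot e f = 0, dot e u = 0 & dot f u = 0].

(* [e] and [f] being centred sides of the rectangle, the inequality for [i, j]
   says that it lies strictly between the two sides of the hexagon which are
   projections of edges of the box in the third direction. *)
Definition fits (a b : R) l u e f :=
  forall i j : 'I_3, (i < j)%N ->
    a * `|e 0 i * u 0 j - e 0 j * u 0 i| +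
    b * `|f 0 i * u 0 j - f 0 j * u 0 i| < l 0 i * u 0 j + l 0 j * u 0 i.

Lemma fits_vec3 (a b l0 l1 l2 x y z e0 e1 e2 f0 f1 f2 : R) :
  a * `|e0 * y - e1 * x| + b * `|f0 * y - f1 * x| < l0 * y + l1 * x ->
  a * `|e0 * z - e2 * x| + b * `|f0 * z - f2 * x| < l0 * z + l2 * x ->
  a * `|e1 * z - e2 * y| + b * `|f1 * z - f2 * y| < l1 * z + l2 * y ->
  fits a b (vec3 l0 l1 l2) (vec3 x y z) (vec3 e0 e1 e2) (vec3 f0 f1 f2).
Proof.
by move=> ? ? ?; rewrite /fits;
  apply: forall_ord3; apply: forall_ord3 => //= _; rewrite !mxE.
Qed.

Lemma dot_vec3 (x y z x' y' z' : R) :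
  dot (vec3 x y z) (vec3 x' y' z') = x * x' + y * y' + z * z'.
Proof. by rewrite /dot sum_ord3 !mxE. Qed.

Lemma exists_fitting_frame (a b c : R) u :
  0 < a -> a <= b -> b <= c -> (forall i, 0 < u 0 i) ->
  exists e f, is_frame u e f /\ fits a b (vec3 a b c) u e f.
Proof.
move=> a0 ab bc; rewrite (vec3_eta u).
move: (u 0 0) (u 0 1) (u 0 2) => x y z u0.
have x0 : 0 < x by have := u0 0; rewrite mxE.
have y0 : 0 < y by have := u0 1; rewrite mxE.
have z0 : 0 < z by have := u0 2; rewrite mxE.
have b0 : 0 < b by lra.
(* [N] is the length of [u]; after [clearbody], only its positivity and its square are available. *)
pose N := Num.sqrt (x ^+ 2 + y ^+ 2 + z ^+ 2).
have N0 : 0 < N by rewrite sqrtr_gt0; nra.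
have NE : N ^+ 2 = x ^+ 2 + y ^+ 2 + z ^+ 2 by rewrite sqr_sqrtr//; nra.
have nz := lt0r_neq0 N0; clearbody N.
have sqrt_sum (p q : R) : 0 < p -> 0 < q ->
    exists s, [/\ 0 < s, s != 0, s ^+ 2 = p ^+ 2 + q ^+ 2 & s < p + q].
  move=> p0 q0; have pq : 0 < p ^+ 2 + q ^+ 2 by nra.
  have s0 : 0 < Num.sqrt (p ^+ 2 + q ^+ 2) by rewrite sqrtr_gt0.
  have sE := sqr_sqrtr (ltW pq).
  exists (Num.sqrt (p ^+ 2 + q ^+ 2)); split => //; first exact: lt0r_neq0.
  by nra.
(* The three choices of the frame make [f 0 0], [e 0 2] or [e 0 1] vanish. *)
have [/andP[xy xz]|/nandP] := boolP ((a * x <= b * y) && (a * x <= b * z)).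
  have [s [s0 sn sE ss]] := sqrt_sum _ _ y0 z0.
  have NE' : N ^+ 2 = x ^+ 2 + s ^+ 2 by rewrite NE sE addrA.
  have sE' : s ^+ 2 = z ^+ 2 + y ^+ 2 by rewrite sE addrC.
  have k1 := sub_norm_lt a0 b0 x0 y0 z0 s0 N0 sE NE' xy.
  have k2 := sub_norm_lt a0 b0 x0 z0 y0 s0 N0 sE' NE' xz.
  (* [f] is the unit vector orthogonal to [u] and to the first axis; [e] is the cross product of [u]
     and [f] divided by [N]. *)
  exists (vec3 (- s / N) (x * y / (s * N)) (x * z / (s * N))).
  exists (vec3 0 (z / s) (- y / s)); split.
    split; rewrite !dot_vec3.
    - transitivity ((s ^+ 4 + x ^+ 2 * (y ^+ 2 + z ^+ 2)) / (s ^+ 2 * N ^+ 2)).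
        by field; rewrite ?nz ?sn.
      by rewrite -sE NE'; field; rewrite -NE' ?expf_neq0 ?sn ?nz.
    - transitivity ((y ^+ 2 + z ^+ 2) / s ^+ 2); first by field.
      by rewrite -sE divff// expf_neq0.
    - by field; rewrite ?nz ?sn.
    - transitivity (x * (y ^+ 2 + z ^+ 2 - s ^+ 2) / (s * N)).
        by field; rewrite ?nz ?sn.
      by rewrite sE subrr mulr0 mul0r.
    - by field.
  (* The first two inequalities are [k1] and [k2], the latter with [b <= c]. In the third, [e]
     contributes nothing, and [s < y + z] suffices. *)
  apply: fits_vec3.
  - apply: (@normM_add_lt _ _ _ _ _ (y * N) (z * x) s);
      rewrite ?mulr_ge0 ?ltW//.
    + right; transitivity (- y * (x ^+ 2 + s ^+ 2) / N);
        first by field; rewrite ?nz ?sn.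
      by rewrite -NE'; field.
    + by right; field.
    + by lra.
  - apply: (@normM_add_lt _ _ _ _ _ (z * N) (y * x) s);
      rewrite ?mulr_ge0 ?ltW//.
    + right; transitivity (- z * (x ^+ 2 + s ^+ 2) / N);
        first by field; rewrite ?nz ?sn.
      by rewrite -NE'; field.
    + by left; field.
    + have : b * x * s <= c * x * s by rewrite !ler_wpM2r// ltW.
      by lra.
  - apply: (@normM_add_lt _ _ _ _ _ 0 (s ^+ 2) s);
      rewrite ?lexx ?exprn_ge0 ?ltW//.
    + by left; field; rewrite ?nz ?sn.
    + by left; rewrite sE; field.
    + rewrite mulr0 add0r expr2 mulrCA ltr_pM2l//.
      have : b * s < b * (y + z) by rewrite ltr_pM2l.
      have : b * y <= c * y by rewrite ler_wpM2r// ltW.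
      by lra.
move=> nle.
(* If [a * x] exceeds one of [b * y] and [b * z], it exceeds [b] times the smaller of [y] and
   [z]. *)
have [[zy zx]|[yz yx]] : z <= y /\ b * z <= a * x \/ y <= z /\ b * y <= a * x.
  by case: nle; rewrite -ltNge => ?; case: (leP z y) => ?; nra.
- have [s [s0 sn sE ss]] := sqrt_sum _ _ x0 y0.
  have NE' : N ^+ 2 = z ^+ 2 + s ^+ 2 by rewrite NE sE addrC.
  have sE' : s ^+ 2 = y ^+ 2 + x ^+ 2 by rewrite sE addrC.
  (* Here [z] takes the place of [x], and [a] and [b] are exchanged; [k2] uses [b] on both sides,
     and [a <= b] makes up the difference later. *)
  have k1 := sub_norm_lt b0 a0 z0 x0 y0 s0 N0 sE NE' zx.
  have bzy : b * z <= b * y by rewrite ler_wpM2l// ltW.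
  have k2 := sub_norm_lt b0 b0 z0 y0 x0 s0 N0 sE' NE' bzy.
  exists (vec3 (- y / s) (x / s) 0).
  exists (vec3 (x * z / (s * N)) (y * z / (s * N)) (- s / N)); split.
    split; rewrite !dot_vec3.
    - transitivity ((x ^+ 2 + y ^+ 2) / s ^+ 2); first by field.
      by rewrite -sE divff// expf_neq0.
    - transitivity ((s ^+ 4 + z ^+ 2 * (x ^+ 2 + y ^+ 2)) / (s ^+ 2 * N ^+ 2)).
        by field; rewrite ?nz ?sn.
      by rewrite -sE NE'; field; rewrite -NE' ?expf_neq0 ?sn ?nz.
    - by field; rewrite ?nz ?sn.
    - by field.
    - transitivity (z * (x ^+ 2 + y ^+ 2 - s ^+ 2) / (s * N)).
        by field; rewrite ?nz ?sn.
      by rewrite sE subrr mulr0 mul0r.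
  apply: fits_vec3.
  - apply: (@normM_add_lt _ _ _ _ _ (s ^+ 2) 0 s);
      rewrite ?lexx ?exprn_ge0 ?ltW//.
    + by right; rewrite sE; field.
    + by left; field; rewrite ?nz ?sn.
    + rewrite mulr0 addr0 expr2 mulrCA ltr_pM2l//.
      have : a * s < a * (x + y) by rewrite ltr_pM2l.
      have : a * x <= b * x by rewrite ler_wpM2r// ltW.
      by lra.
  - apply: (@normM_add_lt _ _ _ _ _ (y * z) (x * N) s);
      rewrite ?mulr_ge0 ?ltW//.
    + by right; field.
    + left; transitivity (x * (z ^+ 2 + s ^+ 2) / N);
        first by field; rewrite ?nz ?sn.
      by rewrite -NE'; field.
    + have : b * x * s <= c * x * s by rewrite !ler_wpM2r// ltW.
      by lra.
  - apply: (@normM_add_lt _ _ _ _ _ (x * z) (y * N) s);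
      rewrite ?mulr_ge0 ?ltW//.
    + by left; field.
    + left; transitivity (y * (z ^+ 2 + s ^+ 2) / N);
        first by field; rewrite ?nz ?sn.
      by rewrite -NE'; field.
    + have : b * y * s <= c * y * s by rewrite !ler_wpM2r// ltW.
      have : a * (x * z) <= b * (x * z) by rewrite ler_wpM2r// mulr_ge0 ?ltW.
      by lra.
(* The previous case with the directions of [y] and [z] exchanged; since the edges [b] and [c] stay
   in place, the final estimates differ. *)
- have [s [s0 sn sE ss]] := sqrt_sum _ _ x0 z0.
  have NE' : N ^+ 2 = y ^+ 2 + s ^+ 2 by rewrite NE sE; ring.
  have sE' : s ^+ 2 = z ^+ 2 + x ^+ 2 by rewrite sE addrC.
  have k1 := sub_norm_lt b0 a0 y0 x0 z0 s0 N0 sE NE' yx.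
  have byz : b * y <= b * z by rewrite ler_wpM2l// ltW.
  have k2 := sub_norm_lt b0 b0 y0 z0 x0 s0 N0 sE' NE' byz.
  exists (vec3 (- z / s) 0 (x / s)).
  exists (vec3 (x * y / (s * N)) (- s / N) (y * z / (s * N))); split.
    split; rewrite !dot_vec3.
    - transitivity ((x ^+ 2 + z ^+ 2) / s ^+ 2); first by field.
      by rewrite -sE divff// expf_neq0.
    - transitivity ((s ^+ 4 + y ^+ 2 * (x ^+ 2 + z ^+ 2)) / (s ^+ 2 * N ^+ 2)).
        by field; rewrite ?nz ?sn.
      by rewrite -sE NE'; field; rewrite -NE' ?expf_neq0 ?sn ?nz.
    - by field; rewrite ?nz ?sn.
    - by field.
    - transitivity (y * (x ^+ 2 + z ^+ 2 - s ^+ 2) / (s * N)).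
        by field; rewrite ?nz ?sn.
      by rewrite sE subrr mulr0 mul0r.
  apply: fits_vec3.
  - apply: (@normM_add_lt _ _ _ _ _ (z * y) (x * N) s);
      rewrite ?mulr_ge0 ?ltW//.
    + by right; field.
    + left; transitivity (x * (y ^+ 2 + s ^+ 2) / N);
        first by field; rewrite ?nz ?sn.
      by rewrite -NE'; field.
    + by lra.
  - apply: (@normM_add_lt _ _ _ _ _ (s ^+ 2) 0 s);
      rewrite ?lexx ?exprn_ge0 ?ltW//.
    + by right; rewrite sE; field.
    + by left; field; rewrite ?nz ?sn.
    + rewrite mulr0 addr0 expr2 mulrCA ltr_pM2l//.
      have : a * s < a * (x + z) by rewrite ltr_pM2l.
      have : a * x <= c * x by rewrite ler_wpM2r ?(le_trans ab)// ltW.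
      by lra.
  - apply: (@normM_add_lt _ _ _ _ _ (x * y) (z * N) s);
      rewrite ?mulr_ge0 ?ltW//.
    + by right; field.
    + right; transitivity (- z * (y ^+ 2 + s ^+ 2) / N);
        first by field; rewrite ?nz ?sn.
      by rewrite -NE'; field.
    + have : b * y * s <= c * y * s by rewrite !ler_wpM2r// ltW.
      have : a * (x * y) <= b * (x * y) by rewrite ler_wpM2r// mulr_ge0 ?ltW.
      by lra.
Qed.

End Frame.

(** * Boxes, their projections and the rectangle inside *)

Section Boxes.
Variable R : realType.
Implicit Types (n p q x y u e f : 'rV[R]_3) (d : R) (E : 'M[R]_3).

(* The box with corner [p] can be described from any of its corners; the one
   chosen makes every component of [n] along the edges nonnegative. *)
Lemma brick_nonneg_frame (l : 3.-tuple R) p E n : E *m E^T = 1%:M ->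
  exists p' E', [/\ E' *m E'^T = 1%:M, brick l p E = brick l p' E' &
    forall i, 0 <= (n *m E'^T) 0 i].
Proof.
move=> EE; pose neg i := (n *m E^T) 0 i < 0.
pose s : 'rV[R]_3 := \row_i (if neg i then -1 else 1).
pose w : 'rV[R]_3 := \row_i (if neg i then tnth l i else 0).
have ss : diag_mx s *m diag_mx s = 1%:M.
  rewrite mulmx_diag -diag_const_mx; congr diag_mx.
  by apply/rowP => i; rewrite !mxE; case: ifP; rewrite ?mulrNN mulr1.
exists (p + w *m E), (diag_mx s *m E); split.
- by rewrite trmx_mul tr_diag_mx mulmxA -(mulmxA _ E) EE mulmx1.
(* [flip] replaces [t 0 i] by [tnth l i - t 0 i] along the reversed edges. It is an involution, so
   it gives both inclusions. *)
- have flip (t : 'rV[R]_3) : (forall i, 0 <= t 0 i <= tnth l i) ->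
      forall i, 0 <= (w + t *m diag_mx s) 0 i <= tnth l i.
    move=> tl i; have := tl i; rewrite mxE mul_mx_diag !mxE.
    by case: ifP => _ /andP[? ?]; apply/andP; split; lra.
  apply/seteqP; split => _ [t tl <-] /=; exists (w + t *m diag_mx s).
  + exact: flip.
  + rewrite -addrA; congr (_ + _).
    rewrite mulmxA -mulmxDl; congr (_ *m E).
    rewrite mulmxDl -(mulmxA t) ss mulmx1 addrA -[RHS]add0r; congr (_ + _).
    apply/rowP => i; rewrite mxE mul_mx_diag !mxE.
    by case: ifP => _; ring.
  + exact: flip.
  + by rewrite mulmxDl addrA mulmxA.
- move=> i; rewrite trmx_mul tr_diag_mx mulmxA mul_mx_diag mxE [s 0 i]mxE.
  by case: ifP => [/ltW|/negbT]; rewrite ?mulrN1 ?oppr_ge0 ?mulr1// leNgt.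
Qed.

(** A point [y] of the plane near the projection [x] is the projection of the box point with
    coordinates [t + (y - x) *m E^T]. These depend continuously on [y], so they stay within the
    bounds. *)
Lemma proj_interior_brick (l : 3.-tuple R) p E n d (t : 'rV[R]_3) :
  n != 0 -> E *m E^T = 1%:M -> (forall i, 0 < t 0 i < tnth l i) ->
  relint (plane n d) (orth_proj n d @` brick l p E)
    (orth_proj n d (p + t *m E)).
Proof.
move=> n0 EE tl; set x := orth_proj n d _.
have xP : plane n d x := orth_proj_plane d _ n0.
pose g y i := t 0 i + ((y - x) *m E^T) 0 i.
have gx i : g x i = t 0 i by rewrite /g subrr mul0mx mxE addr0.
have gc i : continuous (fun y => g y i).
  move=> y; apply: continuousD; first exact: cst_continuous.
  rewrite (_ : (fun _ => _) =
      fun y => \sum_(j < 3) (y 0 j - x 0 j) * E^T j i); last first.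
    by apply/funext => v; rewrite mxE; apply: eq_bigr => j _; rewrite !mxE.
  apply: (continuous_big (op := +%R)) => [|j _ v]; first exact: add_continuous.
  apply: (@continuousM R _ (fun y => y 0 j - x 0 j) (cst (E^T j i)));
    last exact: cst_continuous.
  apply: (@continuousB _ _ _ (fun y => y 0 j) (cst (x 0 j)));
    last exact: cst_continuous.
  exact: coord_continuous.
suff : within (plane n d) (nbhs x) (orth_proj n d @` brick l p E).
  by rewrite (nbhs_subspace_in xP).
have near_g : \forall y \near x, forall i, 0 < g y i < tnth l i.
  apply: (@filter_forall _ _ (fun i y => 0 < g y i < tnth l i) (nbhs x)) => i.
  have /andP[ti0 til] := tl i.
  have lo : \forall y \near x, 0 < g y i.
    by apply: (cvgr_gt _ (gc i x)); rewrite gx.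
  have hi : \forall y \near x, g y i < tnth l i.
    by apply: (cvgr_lt _ (gc i x)); rewrite gx.
  by apply: filterS2 lo hi => y -> ->.
apply: filterS near_g => y gy yP.
exists (p + (t + (y - x) *m E^T) *m E).
  exists (t + (y - x) *m E^T) => // i.
  by rewrite mxE; have /andP[? ?] := gy i; rewrite !ltW.
rewrite mulmxDl mul_tr_orthonormal// addrA orth_projD.
  by rewrite -/x addrC subrK.
by rewrite dotBl yP xP subrr.
Qed.

(** Lifts a point of the centred rectangle along [u] into the open centred box: the strip
    inequalities are the pairwise conditions of [exists_shift], with half edges as bounds. *)
Lemma fits_shift (a b : R) (l u e f : 'rV[R]_3) (s r : R) :
  (forall i, 0 < u 0 i) -> (forall i, 0 < l 0 i) -> fits a b l u e f ->
  `|s| <= a / 2 -> `|r| <= b / 2 ->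
  exists t, forall i, `|(s *: e + r *: f + t *: u) 0 i| < l 0 i / 2.
Proof.
move=> u0 l0 efl sa rb; pose x := s *: e + r *: f; pose m := 2^-1 *: l.
have xm (i j : 'I_3) : (i < j)%N -> `|x 0 i * u 0 j - x 0 j * u 0 i| <
    m 0 i * u 0 j + m 0 j * u 0 i.
  move=> ij; have := efl _ _ ij; rewrite !mxE.
  set X := e 0 i * _ - _; set Y := f 0 i * _ - _ => lt.
  have -> : (s * e 0 i + r * f 0 i) * u 0 j - (s * e 0 j + r * f 0 j) * u 0 i
            = s * X + r * Y by rewrite /X /Y; ring.
  apply: le_lt_trans (ler_normD _ _) _; rewrite !normrM.
  have := ler_wpM2r (normr_ge0 X) sa; have := ler_wpM2r (normr_ge0 Y) rb.
  by lra.
have [|t xt] := @exists_shift R 2 m x u u0.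
  move=> i j; have [ij|ji|/val_inj ->] := ltngtP i j.
  - exact: le_lt_trans (ler_norm _) (xm _ _ ij).
  - rewrite -opprB [ltRHS]addrC; apply: le_lt_trans (xm _ _ ji).
    by rewrite -normrN ler_norm.
  - by rewrite subrr mxE; have := mulr_gt0 (l0 j) (u0 j); lra.
exists t => i; have := xt i; rewrite /m /x !mxE; lra.
Qed.

(** Each point of the rectangle is the projection of an interior point of the box, found by moving
    along [n]. That the rectangle lies in the plane is recorded for the construction of the
    tunnel. *)
Lemma rectangle_in_projection (a b c d : R) p E n :
  0 < a -> a <= b -> b <= c -> n != 0 -> E *m E^T = 1%:M ->
  (forall i, 0 < (n *m E^T) 0 i) ->
  exists q (F : 'M[R]_(2, 3)),
    [/\ F *m F^T = 1%:M, F *m n^T = 0, plane n d q &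
      brick [tuple a; b] q F `<=`
        relint (plane n d) (orth_proj n d @` brick [tuple a; b; c] p E)].
Proof.
move=> a0 ab bc n0 EE u0; set u := n *m E^T.
have [e [f [[ee ff ef eu fu] efl]]] := exists_fitting_frame a0 ab bc u0.
have uE : u *m E = n by rewrite mul_tr_orthonormal.
have en : dot (e *m E) n = 0 by rewrite -uE dot_mul_orthonormal.
have fn : dot (f *m E) n = 0 by rewrite -uE dot_mul_orthonormal.
pose G : 'M[R]_(2, 3) := \matrix_(i, j) (if i == 0 then e else f) 0 j.
have rG (r : 'rV[R]_2) : r *m G = r 0 0 *: e + r 0 1 *: f.
  apply/rowP => j; rewrite !mxE !big_ord_recl big_ord0 !mxE /= addr0.
  by congr (_ + r 0 _ * _); apply/val_inj.
(* [m] is the centre of the box in its own frame; [q] is the projected centre minus half of each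
   side. *)
pose m := 2^-1 *: vec3 a b c.
pose q := orth_proj n d (p + (m - (a / 2) *: e - (b / 2) *: f) *m E).
exists q, (G *m E); split.
- rewrite trmx_mul mulmxA -(mulmxA _ E) EE mulmx1.
  apply/matrixP; apply: forall_ord2; apply: forall_ord2;
    rewrite [LHS]mxE [RHS]mxE /=.
  + by rewrite -[RHS]ee; apply: eq_bigr => i _; rewrite !mxE.
  + by rewrite -[RHS]ef; apply: eq_bigr => i _; rewrite !mxE.
  + by rewrite -[RHS]ef dotC; apply: eq_bigr => i _; rewrite !mxE.
  + by rewrite -[RHS]ff; apply: eq_bigr => i _; rewrite !mxE.
- rewrite -uE trmx_mul mulmxA -(mulmxA _ E) EE mulmx1.
  apply/matrixP => i j; rewrite (ord1 j) {j}; move: i; apply: forall_ord2;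
    rewrite [LHS]mxE [RHS]mxE.
  + by rewrite -[RHS]eu; apply: eq_bigr => i _; rewrite !mxE.
  + by rewrite -[RHS]fu; apply: eq_bigr => i _; rewrite !mxE.
- exact: orth_proj_plane.
move=> _ [r rab <-].
have /andP[r00 r0a] : 0 <= r 0 0 <= a := rab 0.
have /andP[r10 r1b] : 0 <= r 0 1 <= b := rab 1.
have l0 i : 0 < vec3 a b c 0 i
  by move: i; apply: forall_ord3; rewrite mxE /=; lra.
have [||t xt]
  := @fits_shift a b _ u e f (r 0 0 - a / 2) (r 0 1 - b / 2) u0 l0 efl.
- by rewrite ler_norml; apply/andP; split; lra.
- by rewrite ler_norml; apply/andP; split; lra.
set x := (_ + t *: u) in xt.
have -> : q + r *m (G *m E) = orth_proj n d (p + (m + x) *m E).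
  rewrite mulmxA rG.
  have -> : p + (m + x) *m E = p + (m - (a / 2) *: e - (b / 2) *: f) *m E +
      (r 0 0 *: e + r 0 1 *: f) *m E + t *: n.
    rewrite -uE scalemxAl -!addrA -!mulmxDl; congr (p + _ *m E).
    by apply/rowP => j; rewrite !mxE; ring.
  rewrite orth_projDn// orth_projD// mulmxDl dotDl -!scalemxAl !dotZl.
  by rewrite en fn !mulr0 addr0.
apply: proj_interior_brick => //.
have lE i : vec3 a b c 0 i = tnth [tuple a; b; c] i by rewrite mxE (tnth_nth 0).
move=> i; have := xt i; rewrite -lE ltr_norml [(m + x) 0 i]mxE [m 0 i]mxE.
move: (x 0 i) (vec3 a b c 0 i) => xi li.
by move=> /andP[? ?]; apply/andP; split; lra.
Qed.

(* A corner is an extreme point, so it is one of the [p i]; as the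
   parallelogram has only four corners, some [p j] is a convex combination of
   the others. *)
Lemma parallelogram_not_hexagon (P : set 'rV[R]_3) q g h :
  dot g h = 0 -> 0 < dot g g -> 0 < dot h h ->
  ~ is_hexagon P [set q + z.1 *: g + z.2 *: h | z in
      [set z : R * R | 0 <= z.1 <= 1 /\ 0 <= z.2 <= 1]].
Proof.
move=> gh gg hh [p [_ pE HE]].
set H := [set _ | _ in _] in HE.
have pH i : H (p i).
  rewrite HE; exists (fun j => (j == i)%:R); split => [j _||].
  - exact: ler0n.
  - by rewrite (bigD1 i)//= eqxx big1 ?addr0// => j /negbTE ->.
  - rewrite (bigD1 i)//= eqxx scale1r big1 ?addr0// => j /negbTE ->.
    by rewrite scale0r.
have /choice[z zP] i : exists z : R * R,
    (0 <= z.1 <= 1 /\ 0 <= z.2 <= 1) /\ q + z.1 *: g + z.2 *: h = p i.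
  by have [z z01 <-] := pH i; exists z.
(* [gap b s] is the distance from [s] in the unit interval to its endpoint [b]. *)
pose gap (b : bool) (s : R) := if b then 1 - s else s.
have gap_ge0 b (s : R) : 0 <= s <= 1 -> 0 <= gap b s.
  by case: b => /andP[? ?]; rewrite /gap ?subr_ge0.
have gap0 b s : gap b s = 0 -> s = b%:R.
  by case: b => //= /eqP; rewrite subr_eq0 => /eqP.
have gap_sum (b : bool) (w s : 'I_6 -> R) : \sum_i w i = 1 ->
    \sum_i w i * s i = b%:R -> \sum_i w i * gap b (s i) = 0.
  case: b => w1 ws //=; transitivity (\sum_i w i - \sum_i w i * s i).
    by rewrite -sumrB; apply: eq_bigr => i _; rewrite mulrBr mulr1.
  by rewrite w1 ws; exact: subrr.
have corner (k : bool * bool) : {i | p i = q + k.1%:R *: g + k.2%:R *: h}.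
  apply: cid; have [w [w0 w1 wE]] : conv_hull predT p
      (q + k.1%:R *: g + k.2%:R *: h).
    by rewrite -HE; exists (k.1%:R, k.2%:R) => //=; case: k => [[] []] /=;
      rewrite !lexx ler01.
  have {wE} : k.1%:R *: g + k.2%:R *: h =
      (\sum_i w i * (z i).1) *: g + (\sum_i w i * (z i).2) *: h.
    apply: (addrI q); rewrite addrA wE !scaler_suml -big_split /=.
    rewrite -{1}[q]scale1r -w1 scaler_suml -big_split /=.
    apply: eq_bigr => i _; have [_ <-] := zP i.
    by rewrite !scalerDr !scalerA addrA.
  move=> kw.
  have k1 : \sum_i w i * (z i).1 = k.1%:R.
    have := congr1 (fun x => dot x g) kw.
    rewrite !dotDl !dotZl (dotC h) gh !mulr0 !addr0 => /mulIf -> //.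
    exact: lt0r_neq0.
  have k2 : \sum_i w i * (z i).2 = k.2%:R.
    have := congr1 (fun x => dot x h) kw.
    rewrite !dotDl !dotZl gh !mulr0 !add0r => /mulIf -> //.
    exact: lt0r_neq0.
  (* A weighted mean of nonnegative gaps is zero, so any [p i] of nonzero weight has both
     coordinates of the corner. *)
  have w_ge0 i : 0 <= w i by exact: w0.
  have [i wi] : exists i, w i != 0.
    apply/existsP; rewrite -[[exists _, _]]negbK negb_exists.
    apply/negP => /forallP w_0.
    have : \sum_i w i = 0 by apply: big1 => i _; apply/eqP/negbNE/w_0.
    by rewrite w1 => /eqP; rewrite oner_eq0.
  have zero (b : bool) (s : 'I_6 -> R) : (forall i, 0 <= s i <= 1) ->
      \sum_i w i * s i = b%:R -> s i = b%:R.
    move=> s01 /(gap_sum _ _ _ w1)/eqP.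
    rewrite psumr_eq0 => [/allP/(_ i (mem_index_enum _))|i' _]; last first.
      by rewrite mulr_ge0 ?gap_ge0.
    by rewrite mulf_eq0 (negbTE wi) => /eqP/gap0.
  exists i; have [_ <-] := zP i.
  rewrite (zero k.1 (fun i => (z i).1))//;
    last by move=> i'; case: (zP i') => -[].
  by rewrite (zero k.2 (fun i => (z i).2))// => i'; case: (zP i') => -[].
pose s k := sval (corner k).
have sE k : p (s k) = q + k.1%:R *: g + k.2%:R *: h := svalP (corner k).
have [j js] : exists j, j \notin codom s.
  apply/existsP; rewrite -negb_forall; apply/negP => /forallP all_s.
  have all_eq : codom s =i predT by move=> i; rewrite all_s.
  have := leq_image_card s predT.
  by rewrite (eq_card all_eq) card_ord card_prod !card_bool.
have sj k : s k != j by apply: contraNneq js => <-; exact: codom_f.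
apply: (pE j); have [[z1 z2] zE] := zP j.
(* Bilinear weights expressing [p j] through the four corners; the weights of corners assigned the
   same index are added up. *)
pose m (k : bool * bool) := gap (~~ k.1) (z j).1 * gap (~~ k.2) (z j).2.
exists (fun i => \sum_(k | s k == i) m k); split.
- by move=> i _; apply: sumr_ge0 => k _; rewrite mulr_ge0// gap_ge0.
- have part : \sum_k m k = \sum_(i | predC1 j i) \sum_(k | s k == i) m k.
    by rewrite (partition_big s (predC1 j)) => // k _; exact: sj.
  rewrite -part sum_bool2 /m /gap /=.
  by ring.
- have <- : \sum_k m k *: p (s k) =
      \sum_(i | predC1 j i) (\sum_(k | s k == i) m k) *: p i.
    rewrite (partition_big s (predC1 j)) => [|k _]; last exact: sj.
    apply: eq_bigr => i _.
    by rewrite scaler_suml; apply: eq_bigr => k /eqP ->.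
  rewrite sum_bool2 !sE /m /gap /= -zE.
  by apply/rowP => i; rewrite !mxE; ring.
Qed.

(** * Strict positivity of the direction in the frame of the box *)

(** If component [i] vanishes, edge [i] is parallel to the plane and the other two edges project
    into a single line orthogonal to it. The projection is then a rectangle, not a hexagon. *)
Lemma hexagon_pos (l : 3.-tuple R) p E n d :
  n != 0 -> E *m E^T = 1%:M -> (forall i, 0 < tnth l i) ->
  (forall i, 0 <= (n *m E^T) 0 i) ->
  is_hexagon (plane n d) (orth_proj n d @` brick l p E) ->
  forall i, 0 < (n *m E^T) 0 i.
Proof.
move=> n0 EE l0; set u := n *m E^T => u0 hex i.
rewrite lt_neqAle u0 andbT; apply/negP => /eqP/esym ui.
have [j [k [ji ki kj sumE]]] := ord3_others i.
have uE : u *m E = n by rewrite mul_tr_orthonormal.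
clearbody u.
have dotE r r' := dot_row_orthonormal r r' EE.
pose e r := row r E.
have eE : n = u 0 j *: e j + u 0 k *: e k.
  by rewrite -uE mulmx_sum_row sumE ui scale0r add0r.
have nn : dot n n = u 0 j ^+ 2 + u 0 k ^+ 2.
  by rewrite -uE dot_mul_orthonormal// /dot sumE ui mulr0 add0r !expr2.
have nu0 := dot_gt0 n0; have nun := lt0r_neq0 nu0.
set nu := dot n n in nn nu0 nun.
(* [W] is [n] turned by a right angle in the plane of [e j] and [e k]; it spans that line. *)
pose W := u 0 k *: e j - u 0 j *: e k.
have [ei_j ei_k ej_k] : [/\ dot (e j) (e i) = 0, dot (e k) (e i) = 0 &
    dot (e k) (e j) = 0] by rewrite !dotE !(negbTE ji, negbTE ki, negbTE kj).
have [ejj ekk] : dot (e j) (e j) = 1 /\ dot (e k) (e k) = 1.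
  by rewrite !dotE !eqxx.
have Wn : dot W n = 0.
  rewrite eE dotC dotBr !dotDl !dotZr !dotZl.
  by rewrite (dotC (e j) (e k)) ej_k ejj ekk; ring.
have WW : dot W W = nu.
  rewrite nn dotBr !dotBl !dotZr !dotZl.
  by rewrite (dotC (e j) (e k)) ej_k ejj ekk; ring.
have ein : dot (e i) n = 0.
  by rewrite dotC eE dotDl !dotZl ei_j ei_k; ring.
have projE (t : 'rV[R]_3) : orth_proj n d (p + t *m E) = orth_proj n d p +
    t 0 i *: e i + ((t 0 j * u 0 k - t 0 k * u 0 j) / nu) *: W.
  have -> : p + t *m E = p + (t 0 i *: e i +
      ((t 0 j * u 0 k - t 0 k * u 0 j) / nu) *: W) +
      ((t 0 j * u 0 j + t 0 k * u 0 k) / nu) *: n.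
    rewrite -!addrA; congr (_ + _).
    rewrite mulmx_sum_row sumE -!addrA; congr (_ + _).
    rewrite /W eE -/(e j) -/(e k); apply/rowP => r; rewrite !mxE.
    by rewrite nn; field; rewrite -nn.
  by rewrite orth_projDn// orth_projD ?addrA// dotDl !dotZl ein Wn; ring.
pose S := tnth l j * u 0 k + tnth l k * u 0 j.
have S0 : 0 < S.
  have [uj uk] := (u0 j, u0 k); have [lj lk] := (l0 j, l0 k).
  have [uj0|uj0] := eqVneq (u 0 j) 0.
    have uk0 : 0 < u 0 k.
      rewrite lt_neqAle uk andbT eq_sym; apply: contraNneq nun => uk0.
      by rewrite nn uj0 uk0 expr0n addr0.
    by rewrite /S uj0 mulr0 addr0 mulr_gt0.
  have {}uj0 : 0 < u 0 j by rewrite lt_neqAle uj eq_sym uj0.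
  by rewrite /S ltr_wpDl ?mulr_ge0 ?mulr_gt0 ?(ltW lj).
have Sn := lt0r_neq0 S0.
(* Along [W], the projection is lowest at [t 0 j = 0], [t 0 k = tnth l k], and its extent is
   [S / nu]. *)
pose q := orth_proj n d p - (tnth l k * u 0 j / nu) *: W.
suff HE : orth_proj n d @` brick l p E =
    [set q + z.1 *: (tnth l i *: e i) + z.2 *: ((S / nu) *: W) | z in
      [set z : R * R | 0 <= z.1 <= 1 /\ 0 <= z.2 <= 1]].
  rewrite HE in hex; apply: parallelogram_not_hexagon hex.
  - by rewrite dotZl dotZr dotC /W dotBl !dotZl ei_j ei_k; ring.
  - by rewrite dotZl dotZr dotE eqxx mulr1 mulr_gt0.
  - by rewrite dotZl dotZr WW !mulr_gt0 ?invr_gt0.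
apply/seteqP; split => [_ [_ [t tl <-] <-]|_ [[y z] /= [y01 z01] <-]].
  have [ti tj tk] := And3 (tl i) (tl j) (tl k).
  exists (t 0 i / tnth l i,
    (t 0 j * u 0 k - t 0 k * u 0 j + tnth l k * u 0 j) / S) => /=.
    split; apply/andP; split.
    - by rewrite divr_ge0 ?(ltW (l0 i))//; case/andP: ti.
    - by rewrite ler_pdivrMr ?mul1r//; case/andP: ti.
    - apply: divr_ge0; last exact: ltW.
      have /andP[tj0 _] := tj; have /andP[_ tkl] := tk.
      have := mulr_ge0 tj0 (u0 k); have := ler_wpM2r (u0 j) tkl; lra.
    - rewrite ler_pdivrMr// mul1r /S.
      have /andP[_ tjl] := tj; have /andP[tk0 _] := tk.
      have := mulr_ge0 tk0 (u0 j); have := ler_wpM2r (u0 k) tjl; lra.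
  rewrite projE /q !scalerA divfK ?lt0r_neq0//.
  by apply/rowP => r; rewrite !mxE; field; rewrite nun Sn.
(* Preimage on the diagonal from the lowest to the highest position along [W]. *)
pose t : 'rV[R]_3 := \row_r (if r == i then y * tnth l i else
  if r == j then z * tnth l j else (1 - z) * tnth l k).
have [tiE tjE tkE] : [/\ t 0 i = y * tnth l i, t 0 j = z * tnth l j &
    t 0 k = (1 - z) * tnth l k].
  by rewrite !mxE !eqxx (negbTE ji) (negbTE ki) (negbTE kj).
exists (p + t *m E); last first.
  rewrite projE tiE tjE tkE /q /S; move: (orth_proj n d p) => o.
  by apply/rowP => r; rewrite !mxE; field.
exists t => // r.
have: [|| r == i, r == j | r == k].
  apply/negPn/negP; rewrite !negb_or => /and3P[ri rj rk].
  (* Were [r] none of the three indices, its indicator would sum to one on the left and to zero on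
     the right. *)
  have := sumE nat (fun r' => (r == r') : nat).
  by rewrite (bigD1 r)//= eqxx (negbTE ri) (negbTE rj) (negbTE rk).
have scale (w c : R) : 0 <= w <= 1 -> 0 < c -> 0 <= w * c <= c.
  by move=> /andP[w0 w1] c0; rewrite ger_pMl// w1 mulr_ge0// ltW.
case/or3P => /eqP ->; rewrite ?tiE ?tjE ?tkE; apply: scale => //.
by move: z01 => /andP[? ?]; apply/andP; split; lra.
Qed.

(** If component [i] vanishes, the face at coordinate zero contains a short segment from the corner
    [p] in direction [v]. *)
Lemma not_parallel_pos (l : 3.-tuple R) p E v :
  E *m E^T = 1%:M -> (forall i, 0 < tnth l i) ->
  (forall i, 0 <= (v *m E^T) 0 i) ->
  (forall F, is_face (brick l p E) F -> ~ parallel v F) ->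
  forall i, 0 < (v *m E^T) 0 i.
Proof.
move=> EE l0; set u := v *m E^T => u0 npar i.
rewrite lt_neqAle u0 andbT; apply/negP => /eqP/esym ui.
have uE : u *m E = v by rewrite mul_tr_orthonormal.
(* Dividing by this [k] brings every component of [u] below the corresponding edge length; the
   summand [1] keeps [k] positive. *)
pose k := 1 + \sum_j u 0 j / tnth l j.
have ul0 j : 0 <= u 0 j / tnth l j by rewrite divr_ge0// ltW.
have k0 : 0 < k by rewrite ltr_pwDl// sumr_ge0.
have kn := lt0r_neq0 k0.
apply: (npar (brick_side l p E i false)).
  by exists l, p, E; split => //; exists i, false.
exists p, (p + (k^-1 *: u) *m E), k; split.
- exists 0; last by rewrite mul0mx addr0.
  by split=> [j|]; rewrite mxE ?lexx ?ltW.
- exists (k^-1 *: u) => //; split=> [j|]; last by rewrite mxE ui mulr0.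
  rewrite mxE mulr_ge0 ?invr_ge0 ?(ltW k0)//= mulrC ler_pdivrMr// mulrC.
  rewrite -ler_pdivrMr// /k (bigD1 j)//= addrCA lerDl.
  by rewrite addr_ge0 ?sumr_ge0.
- by rewrite addrC addKr -scalemxAl uE scalerA divff// scale1r.
Qed.

(** * From the rectangle to the tunnel *)

Lemma rupert_passage_of_rectangle (a b c : R) p q E (F : 'M[R]_(2, 3)) v :
  E *m E^T = 1%:M -> F *m F^T = 1%:M -> F *m v^T = 0 -> v != 0 ->
  plane v 0 q ->
  brick [tuple a; b] q F `<=`
    relint (plane v 0) (orth_proj v 0 @` brick [tuple a; b; c] p E) ->
  rupert_passage (brick [tuple a; b; c] p E) v.
Proof.
move=> EE FF Fv v0 qv sub.
have vv := dot_gt0 v0.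
pose k := (Num.sqrt (dot v v))^-1.
have kk : k * (k * dot v v) = 1.
  rewrite mulrA -invfM -expr2 sqr_sqrtr ?ltW// mulVf//; exact: lt0r_neq0.
pose E' : 'M[R]_3 :=
  \matrix_(i < 3) (if i == 0 then row 0 F
    else if i == 1 then row 1 F else k *: v).
have rF i : dot (row i F) v = 0.
  by rewrite -(row_id 0 v) -mulmx_trE Fv mxE.
have E'E' : E' *m E'^T = 1%:M.
  apply/matrixP => i j; rewrite mulmx_trE !rowK [RHS]mxE.
  move: i j; apply: forall_ord3; apply: forall_ord3 => /=;
    by rewrite ?dotZr ?(dotC (k *: v)) ?dotZr ?rF ?mulr0 ?kk
      ?(dot_row_orthonormal _ _ FF).
(* The orthogonal map [Q] sends the edge directions of the box to the two sides of the rectangle and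
   the unit vector along [v]. *)
pose Q := E^T *m E'.
have QQ : Q *m Q^T = 1%:M.
  by rewrite trmx_mul mulmxA -(mulmxA _ E') E'E' mulmx1 trmxK (mulmx1C EE).
pose f x := q + (x - p) *m Q.
exists (f @` brick [tuple a; b; c] p E).
  exists f; split=> // x y; rewrite /eucl_dist; congr Num.sqrt.
  have -> : f x - f y = (x - y) *m Q.
    by rewrite /f opprD addrACA subrr add0r -mulmxBl opprB addrA subrK.
  exact: dot_mul_orthonormal.
move=> _ [_ [_ [t tl <-] <-] <-]; apply: sub.
pose r : 'rV[R]_2 := \row_i t 0 (widen_ord (leqnSn 2) i).
exists r.
  apply: forall_ord2; rewrite mxE; [have := tl 0|have := tl 1];
    by congr (0 <= t 0 _ <= _); apply/val_inj.
(* The third edge runs along [v] and disappears in the projection, which leaves a point of the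
   rectangle. *)
have -> : f (p + t *m E) = q + r *m F + (t 0 2 * k) *: v.
  rewrite /f [p + _]addrC addrK /Q mulmxA -(mulmxA t) EE mulmx1 -addrA.
  congr (_ + _); rewrite mulmx_sum_row sum_ord3 !rowK /= scalerA.
  congr (_ + _); rewrite mulmx_sum_row !big_ord_recl big_ord0 addr0 !mxE.
  by congr (t 0 _ *: row _ F + t 0 _ *: row _ F); apply/val_inj.
rewrite orth_projDn// orth_projD; first by rewrite orth_proj_id.
by rewrite dot_mulmx -mulmxA Fv mulmx0 mxE.
Qed.

End Boxes.

(** * Rectangles in hexagonal projections, and passages for boxes and cubes *)

Theorem theorem1 (R : realType) :
  (forall (a b c : R) (B : set 'rV[R]_3),
     0 < a -> a <= b -> b <= c -> is_box a b c B ->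
     (forall (n : 'rV[R]_3) (d : R), n != 0 ->
        is_hexagon (plane n d) (orth_proj n d @` B) ->
        exists2 T : set 'rV[R]_3, is_rectangle a b T &
          T `<=` relint (plane n d) (orth_proj n d @` B)) /\
     (forall v : 'rV[R]_3, v != 0 ->
        (forall F, is_face B F -> ~ parallel v F) ->
        rupert_passage B v)) /\
  (forall B : set 'rV[R]_3, is_cube B ->
     forall v : 'rV[R]_3, v != 0 ->
       (forall F, is_face B F -> ~ parallel v F) ->
       rupert_passage B v).
Proof.
have pos (a b c : R) : 0 < a -> a <= b -> b <= c ->
    forall i, 0 < tnth [tuple a; b; c] i.
  by move=> a0 ab bc; apply: forall_ord3; rewrite (tnth_nth 0) /=; lra.
have main (a b c : R) (B : set 'rV[R]_3) : 0 < a -> a <= b -> b <= c ->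
    is_box a b c B -> forall v, v != 0 ->
    (forall F, is_face B F -> ~ parallel v F) -> rupert_passage B v.
  move=> a0 ab bc [p0 [E0 [EE0 ->]]] v v0.
  (* Re-choosing the corner makes all components nonnegative; the assumption on the faces then makes
     them positive. *)
  have [p [E [EE -> u0]]] := brick_nonneg_frame [tuple a; b; c] p0 v EE0.
  move=> /(not_parallel_pos EE (pos _ _ _ a0 ab bc) u0) {}u0.
  have [q [F [FF Fv qv sub]]] :=
    rectangle_in_projection 0 p a0 ab bc v0 EE u0.
  exact: rupert_passage_of_rectangle sub.
split=> [a b c B a0 ab bc Bbox|B [s s0 Bs]]; last exact: main Bs.
split; last exact: main Bbox.
move=> n d n0; have [p0 [E0 [EE0 ->]]] := Bbox.
have [p [E [EE -> u0]]] := brick_nonneg_frame [tuple a; b; c] p0 n EE0.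
move=> /(hexagon_pos n0 EE (pos _ _ _ a0 ab bc) u0) {}u0.
have [q [F [FF _ _ sub]]] := rectangle_in_projection d p a0 ab bc n0 EE u0.
by exists (brick [tuple a; b] q F) => //; exists q, F.
Qed.
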